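(* Let $N\ge 2$, $n\ge 1$, let $\mathcal G$ be a strongly connected and weight-balanced digraph on $\{1,\dots,N\}$ with adjacency matrix $(a_{ij})$ and Laplacian $L$, and let $\hat\lambda_2$ be the second smallest eigenvalue of $\frac{L+L^T}{2}$. For each $i\in\{1,\dots,N\}$ let $d_i\in\mathbb R^n$ and let $f_i:\mathbb R^n\to\mathbb R$ be differentiable and $\omega$-strongly convex with a constant $\omega>0$, and suppose that each gradient $\nabla f_i$ is $\theta$-Lipschitz continuous. Let $$k_1>\max\left\{\frac{\|L\|^2(\omega+1)}{\hat\lambda_2\,\omega^2}+\frac{\theta^2}{2\omega},\,1\right\},\qquad k_2>\frac{k_1^2}{\hat\lambda_2^2},\qquad k_3>0 .$$ Consider, for $i\in\{1,\dots,N\}$, the dynamics $$\begin{cases}\dot x_i=-\nabla f_i(x_i)+\mu_i,\\ \dot\mu_i=k_1(\eta_i-x_i+d_i)-k_2\sum_{j=1}^N a_{ij}(\mu_i-\mu_j),\\ \dot\eta_i=-k_3\sum_{j=1}^N a_{ij}\big((\eta_i-x_i+d_i)-(\eta_j-x_j+d_j)\big).\end{cases}$$ Then for every trajectory with initial state satisfying $\sum_{i=1}^N\eta_i(0)=0_n$, the component $x(t)=(x_1(t),\dots,x_N(t))$ converges exponentially to the optimal solution $x^*$ of the problem $$\min_{x\in\mathbb R^{Nn}}\ \sum_{i=1}^N f_i(x_i)\quad\text{subject to}\quad \sum_{i=1}^N x_i=\sum_{i=1}^N d_i ,$$ that is, there is a constant $c>0$ (independent of the initial state) such that for each such trajectory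 there is $C\ge 0$ with $\|x(t)-x^*\|\le C e^{-ct}$ for all $t\ge 0$.
   Context: Digraph: $\mathcal G=(\mathcal V,\mathcal E,\mathcal A)$ with $\mathcal V=\{1,\dots,N\}$, $\mathcal A=(a_{ij})$, $a_{ij}>0$ if $(i,j)\in\mathcal E$ (agent $i$ receives information from agent $j$), $a_{ij}=0$ otherwise, $a_{ii}=0$. $\mathcal G$ is strongly connected if any two nodes are joined by a directed path, and weight-balanced if $\sum_{j}a_{ij}=\sum_j a_{ji}$ for all $i$. The Laplacian is $L=\mathrm{diag}(\sum_j a_{1j},\dots,\sum_j a_{Nj})-\mathcal A$. The eigenvalues of $\frac{L+L^T}{2}$ are ordered $\hat\lambda_1\le\dots\le\hat\lambda_N$. $\|L\|$ is the spectral norm. A differentiable $f:\mathbb R^n\to\mathbb R$ is $\omega$-strongly convex if $(u-v)^T(\nabla f(u)-\nabla f(v))\ge\omega\|u-v\|^2$ for all $u,v$. A map $g$ is $\theta$-Lipschitz if $\|g(u)-g(v)\|\le\theta\|u-v\|$ for all $u,v$. *)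

(* Defs.v *)
From HB Require Import structures.
From mathcomp Require Import all_boot all_order all_algebra.
From mathcomp Require Import all_classical all_reals all_analysis.

Set Implicit Arguments.
Unset Strict Implicit.
Unset Printing Implicit Defensive.
Import Order.TTheory GRing.Theory Num.Theory.
Import numFieldNormedType.Exports.

Local Open Scope classical_set_scope.
Local Open Scope ring_scope.

(* Vectors of R^n are rows ['rV[R]_n].  The norm [`|u|] on matrices is the sup
   norm, so the Euclidean quantities are defined explicitly; the induced
   topology, hence differentiability, is the same. *)

Definition dotv (R : realType) (n : nat) (u v : 'rV[R]_n) : R :=
  \sum_(j < n) u 0 j * v 0 j.

(* Euclidean norm of the vector of all entries: the usual norm for a row or a
   column, and the norm of the stacked vector (u_1, ..., u_N) for a matrix with
   rows u_1, ..., u_N. *)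
Definition enorm (R : realType) (m n : nat) (A : 'M[R]_(m, n)) : R :=
  Num.sqrt (\sum_(i < m) \sum_(j < n) A i j ^+ 2).

(* Operator norm induced by the Euclidean norms. *)
Definition spectral_norm (R : realType) (m n : nat) (A : 'M[R]_(m, n)) : R :=
  sup [set enorm (A *m v) | v in [set v : 'cV[R]_n | enorm v <= 1]].

(* [s] lists the eigenvalues of [A] in nondecreasing order, with multiplicity.
   Such a list is unique if it exists, and it exists for symmetric [A]; its
   size is [n] since [char_poly A] has degree [n]. *)
Definition ordered_eigenvalues (R : realType) (n : nat)
    (A : 'M[R]_n) (s : seq R) : Prop :=
  sorted <=%R s /\ char_poly A = \prod_(l <- s) ('X - l%:P).

(* [edge i j] means that agent [i] receives information from agent [j]. *)
Record wdigraph (R : realType) (N : nat) := WDigraph {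
  edge : rel 'I_N;
  adj : 'M[R]_N;
  adj_gt0 : forall i j, edge i j -> 0 < adj i j;
  adj_eq0 : forall i j, ~~ edge i j -> adj i j = 0;
  adj_diag : forall i, adj i i = 0
}.

Definition strongly_connected (R : realType) (N : nat) (G : wdigraph R N) :
    Prop :=
  forall i j : 'I_N, connect (edge G) i j.

Definition weight_balanced (R : realType) (N : nat) (G : wdigraph R N) :
    Prop :=
  forall i : 'I_N, \sum_(j < N) adj G i j = \sum_(j < N) adj G j i.

Definition laplacian (R : realType) (N : nat) (G : wdigraph R N) : 'M[R]_N :=
  diag_mx (\row_i \sum_(j < N) adj G i j) - adj G.

Definition grad (R : realType) (n : nat) (f : 'rV[R]_n -> R) (u : 'rV[R]_n) :
    'rV[R]_n :=
  \row_(j < n) ('D_('e_j) f u : R).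

Definition strongly_convex (R : realType) (n : nat) (w : R)
    (f : 'rV[R]_n -> R) : Prop :=
  forall u v : 'rV[R]_n,
    w * enorm (u - v) ^+ 2 <= dotv (u - v) (grad f u - grad f v).

Definition elipschitz (R : realType) (m n : nat) (theta : R)
    (g : 'rV[R]_m -> 'rV[R]_n) : Prop :=
  forall u v : 'rV[R]_m, enorm (g u - g v) <= theta * enorm (u - v).

Definition feasible (R : realType) (N n : nat) (d x : 'I_N -> 'rV[R]_n) :
    Prop :=
  \sum_(i < N) x i = \sum_(i < N) d i.

Definition optimal (R : realType) (N n : nat) (f : 'I_N -> 'rV[R]_n -> R)
    (d x : 'I_N -> 'rV[R]_n) : Prop :=
  feasible d x /\
  forall y : 'I_N -> 'rV[R]_n, feasible d y ->
    \sum_(i < N) f i (x i) <= \sum_(i < N) f i (y i).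

(* Solutions on [0, +oo[: continuous there, and satisfying the differential
   equations on ]0, +oo[.  Values at negative times are irrelevant; at time 0,
   the equations hold for the right derivatives as soon as the right-hand sides
   are continuous. *)
Definition trajectory (R : realType) (N n : nat) (G : wdigraph R N)
    (f : 'I_N -> 'rV[R]_n -> R) (d : 'I_N -> 'rV[R]_n) (k1 k2 k3 : R)
    (x mu eta : 'I_N -> R -> 'rV[R]_n) : Prop :=
  forall i : 'I_N,
    [/\ {within `[0, +oo[, continuous (x i)},
        {within `[0, +oo[, continuous (mu i)},
        {within `[0, +oo[, continuous (eta i)} &
        forall t : R, 0 < t ->
        [/\ is_derive t (1 : R) (x i) (- grad (f i) (x i t) + mu i t),
            is_derive t (1 : R) (mu i)
              (k1 *: (eta i t - x i t + d i)
               - k2 *: \sum_(j < N) adj G i j *: (mu i t - mu j t)) &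
            is_derive t (1 : R) (eta i)
              (- (k3 *: \sum_(j < N) adj G i j *:
                   ((eta i t - x i t + d i) - (eta j t - x j t + d j))))]].

(* Main.v *)
Require Import Defs.
From HB Require Import structures.
From mathcomp Require Import all_boot all_order all_algebra.
From mathcomp Require Import all_classical all_reals all_analysis.
From mathcomp Require Import ring lra.
Import Order.TTheory GRing.Theory Num.Theory.
Import numFieldNormedType.Exports.
Set Implicit Arguments.
Unset Strict Implicit.
Unset Printing Implicit Defensive.
Local Open Scope classical_set_scope.
Local Open Scope ring_scope.

(** Write [<A, B>] for the trace inner product, [|A|^2 = <A, A>], [J] for the
    projection of a stacked vector onto its mean, [lam] for the second
    eigenvalue and [nu] for the common value of the gradients at [xs].  In the
    error coordinates [X = x - xs], [M = mu - nu], [H = eta - (xs - d)] the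
    dynamics read
      [X' = - G + M], [M' = k1 (H - X) - k2 L M], [H' = - k3 L (H - X)]
    with [G = grad f (x) - grad f (xs)], and weight balance preserves
    [J H = 0].  For
      [U = k1/2 |X|^2 + 1/2 |M|^2 + 1/(2 k3) |H|^2 - eps <X, J M>]
    the cross terms in [<X, M>] cancel and, with [Q = M - J M],
      [U' = - k1 <X, G> + k1 <Q, H> - k2 <Q, L Q> - <H, L H> + <H, L X>
            + eps <G, J M> - eps |J M|^2 + eps k1 |J X|^2].
    The weight [1/(2 k3)] makes this independent of [k3].  Young's inequality
    and the spectral gap absorb [k1 <Q, H>] thanks to the bound on [k2] and
    [<H, L X>] thanks to the bound on [k1]; a small [eps] supplies the missing
    decay of [J M].  Hence [U' <= - c U]. *)

(** * Trace inner product and spectral norm *)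

Definition frob (R : realType) (m n : nat) (A B : 'M[R]_(m, n)) : R :=
  \tr (A *m B^T).

Lemma frobE (R : realType) m n (A B : 'M[R]_(m, n)) :
  frob A B = \sum_i \sum_j A i j * B i j.
Proof.
rewrite /frob /mxtrace; apply: eq_bigr => i _; rewrite mxE.
by apply: eq_bigr => j _; rewrite mxE.
Qed.

Lemma frobC (R : realType) m n (A B : 'M[R]_(m, n)) : frob A B = frob B A.
Proof.
by rewrite !frobE; apply: eq_bigr => i _; apply: eq_bigr => j _; rewrite mulrC.
Qed.

Lemma frobDl (R : realType) m n (A B C : 'M[R]_(m, n)) : frob (A + B) C = frob A C + frob B C.
Proof. by rewrite /frob mulmxDl mxtraceD. Qed.

Lemma frobNl (R : realType) m n (A B : 'M[R]_(m, n)) : frob (- A) B = - frob A B.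
Proof. by rewrite /frob mulNmx raddfN. Qed.

Lemma frobZl (R : realType) m n a (A B : 'M[R]_(m, n)) : frob (a *: A) B = a * frob A B.
Proof. by rewrite /frob -scalemxAl mxtraceZ. Qed.

Lemma frobDr (R : realType) m n (A B C : 'M[R]_(m, n)) : frob A (B + C) = frob A B + frob A C.
Proof. by rewrite frobC frobDl !(frobC A). Qed.

Lemma frobNr (R : realType) m n (A B : 'M[R]_(m, n)) : frob A (- B) = - frob A B.
Proof. by rewrite frobC frobNl frobC. Qed.

Lemma frobZr (R : realType) m n a (A B : 'M[R]_(m, n)) : frob A (a *: B) = a * frob A B.
Proof. by rewrite frobC frobZl frobC. Qed.

Lemma frob0r (R : realType) m n (A : 'M[R]_(m, n)) : frob A 0 = 0.
Proof. by rewrite -(scale0r (0 : 'M[R]_(m, n))) frobZr mul0r. Qed.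

Definition frob_lin := (frobDl, frobDr, frobNl, frobNr, frobZl, frobZr).

Lemma frob_mulmxr (R : realType) m n p (L : 'M[R]_(m, n)) (A : 'M[R]_(m, p)) (B : 'M[R]_(n, p)) :
  frob A (L *m B) = frob (L^T *m A) B.
Proof. by rewrite /frob trmx_mul mulmxA mxtrace_mulC mulmxA. Qed.

Lemma frob_ge0 (R : realType) m n (A : 'M[R]_(m, n)) : 0 <= frob A A.
Proof.
by rewrite frobE; do 2 (apply: sumr_ge0 => ? _); rewrite -expr2 sqr_ge0.
Qed.

Lemma frob_ge_sqr (R : realType) m n (A : 'M[R]_(m, n)) i j : A i j ^+ 2 <= frob A A.
Proof.
rewrite frobE (bigD1 i)//= (bigD1 j)//= -expr2 -addrA lerDl addr_ge0//.
  by apply: sumr_ge0 => ? _; rewrite -expr2 sqr_ge0.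
by do 2 (apply: sumr_ge0 => ? _); rewrite -expr2 sqr_ge0.
Qed.

Lemma frob_eq0 (R : realType) m n (A : 'M[R]_(m, n)) : frob A A = 0 -> A = 0.
Proof.
move=> A0; apply/matrixP => i j; rewrite mxE; apply/eqP.
by rewrite -sqrf_eq0 eq_le sqr_ge0 andbT -A0 frob_ge_sqr.
Qed.

(** Expand [|2 p A - B|^2 >= 0] and divide by [4 p]. *)
Lemma frob_young (R : realType) m n (p : R) (A B : 'M[R]_(m, n)) : 0 < p ->
  frob A B <= p * frob A A + frob B B / (4 * p).
Proof.
move=> p0; have := frob_ge0 ((2 * p) *: A - B).
rewrite !frob_lin (frobC B A) => h.
have -> : p * frob A A + frob B B / (4 * p) =
  frob A B + (4 * p)^-1 * (2 * p * (2 * p * frob A A + - frob A B) +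
     - (2 * p * frob A B + - frob B B)) by field; rewrite gt_eqF.
by rewrite lerDl mulr_ge0// invr_ge0 mulr_ge0// ltW.
Qed.

Lemma enorm_sqr (R : realType) m n (A : 'M[R]_(m, n)) : enorm A ^+ 2 = frob A A.
Proof.
rewrite frobE /enorm sqr_sqrtr; first by do 2 (apply: eq_bigr => ? _).
by do 2 (apply: sumr_ge0 => ? _); exact: sqr_ge0.
Qed.

Lemma enorm_ge0 (R : realType) m n (A : 'M[R]_(m, n)) : 0 <= enorm A.
Proof. exact: sqrtr_ge0. Qed.

Lemma enormE (R : realType) m n (A : 'M[R]_(m, n)) : enorm A = Num.sqrt (frob A A).
Proof. by rewrite -enorm_sqr sqrtr_sqr ger0_norm// enorm_ge0. Qed.

Lemma enormZ (R : realType) m n a (A : 'M[R]_(m, n)) : enorm (a *: A) = `|a| * enorm A.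
Proof.
by rewrite !enormE !frob_lin mulrA -expr2 sqrtrM ?sqr_ge0// sqrtr_sqr.
Qed.

(** This makes the [sup] in [spectral_norm] a genuine supremum. On the unit ball every entry of [v]
    is at most 1 in absolute value, so the absolute row sums of [A] bound the entries of
    [A *m v]. *)
Lemma spectral_norm_has_sup (R : realType) m n (A : 'M[R]_(m, n)) :
  has_sup [set enorm (A *m v) | v in [set v : 'cV[R]_n | enorm v <= 1]].
Proof.
split; first by exists (enorm (A *m (0 : 'cV_n))), 0 => //=; rewrite enormE frob0r sqrtr0.
exists (Num.sqrt (\sum_i (\sum_j `|A i j|) ^+ 2)) => _ [v /= v1 <-].
rewrite /enorm ler_wsqrtr//; apply: ler_sum => i _.
rewrite big_ord1 -(real_normK (num_real ((A *m v) i 0))) lerXn2r ?nnegrE//.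
  by apply: sumr_ge0.
rewrite mxE (le_trans (ler_norm_sum _ _ _))//; apply: ler_sum => j _.
rewrite normrM ler_piMr// -(ler_pXn2r (n := 2)) ?nnegrE// expr1n real_normK ?num_real//.
by rewrite (le_trans (frob_ge_sqr _ _ _))// -enorm_sqr expr_le1// enorm_ge0.
Qed.

Lemma spectral_normP (R : realType) m n (A : 'M[R]_(m, n)) (v : 'cV[R]_n) :
  enorm (A *m v) <= spectral_norm A * enorm v.
Proof.
have [v0|v0] := eqVneq (enorm v) 0.
  have -> : v = 0 by apply: frob_eq0; rewrite -enorm_sqr v0 expr0n.
  by rewrite mulmx0 !enormE !frob0r sqrtr0 mulr0.
have v_gt0 : 0 < enorm v by rewrite lt_def v0 enorm_ge0.
have -> : A *m v = enorm v *: (A *m ((enorm v)^-1 *: v)).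
  by rewrite -scalemxAr scalerA mulfV// scale1r.
rewrite enormZ ger0_norm ?enorm_ge0// mulrC ler_pM2r//.
apply: sup_upper_bound; first exact: spectral_norm_has_sup.
exists ((enorm v)^-1 *: v) => //=.
by rewrite enormZ gtr0_norm ?invr_gt0// mulVf.
Qed.

Lemma frob_col (R : realType) m n (A B : 'M[R]_(m, n)) :
  frob A B = \sum_j frob (col j A) (col j B).
Proof.
rewrite frobE exchange_big/=; apply: eq_bigr => j _; rewrite frobE.
by apply: eq_bigr => i _; rewrite big_ord1 !mxE.
Qed.

(** A matrix with [p] columns stands for a stacked vector, on which [A] acts as its Kronecker
    product with the identity. Working column by column reduces the bound to single vectors. *)
Lemma frob_spectral_norm (R : realType) m n p (A : 'M[R]_(m, n)) (X : 'M[R]_(n, p)) :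
  frob (A *m X) (A *m X) <= spectral_norm A ^+ 2 * frob X X.
Proof.
rewrite !frob_col mulr_sumr; apply: ler_sum => j _.
rewrite !colE -!mulmxA -!colE -!enorm_sqr -exprMn lerXn2r ?nnegrE ?enorm_ge0//.
  exact: le_trans (enorm_ge0 _) (spectral_normP _ _).
exact: spectral_normP.
Qed.

(** * Simplicity of the eigenvalue zero *)

(** Sylvester's identity: one block matrix is factored both as lower times upper and as upper times
    lower triangular, and the determinants are compared. *)
Lemma det_addmx_mulmx (R : realType) m n (u : 'M[R]_(m, n)) (v : 'M[R]_(n, m)) :
  \det (1%:M + u *m v) = \det (1%:M + v *m u).
Proof.
have h1 : block_mx 1%:M (- u) v 1%:M =
    block_mx 1%:M 0 v 1%:M *m block_mx 1%:M (- u) 0 (1%:M + v *m u).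
  rewrite mulmx_block !mul1mx !mul0mx !mulmx1 !addr0 mulmxN.
  by rewrite addrCA addNr addr0.
have h2 : block_mx 1%:M (- u) v 1%:M =
    block_mx 1%:M (- u) 0 1%:M *m block_mx (1%:M + u *m v) 0 v 1%:M.
  rewrite mulmx_block !mul1mx !mul0mx !mulmx1 !add0r mulNmx.
  by rewrite addrK.
have := congr1 determinant h2; rewrite h1 !det_mulmx.
by rewrite !det_lblock !det_ublock !det1 !mul1r !mulr1.
Qed.

Lemma horner_char_poly (R : realType) n (A : 'M[R]_n) t :
  (char_poly A).[t] = \det (t%:M - A).
Proof.
rewrite /char_poly -/(horner_eval t _) -det_map_mx; congr (\det _).
apply/matrixP => i j.
by rewrite !mxE rmorphB rmorphMn /= /horner_eval hornerC hornerX.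
Qed.

(** The points [1, ..., size (p - q)] would be too many roots of a nonzero difference. Testing at
    positive [t] only permits division by [t]. *)
Lemma poly_eq_pos (R : realType) (p q : {poly R}) :
  (forall t : R, 0 < t -> p.[t] = q.[t]) -> p = q.
Proof.
move=> pq; apply/eqP; rewrite -subr_eq0; apply: contraT => nz.
pose s : seq R := [seq i%:R | i <- iota 1 (size (p - q))].
suff : (size s < size (p - q)%R)%N by rewrite size_map size_iota ltnn.
apply: max_poly_roots => //.
- apply/allP => x /mapP[i]; rewrite mem_iota => /andP[i0 _] ->.
  by rewrite rootE !hornerE pq ?subrr// ltr0n.
- by rewrite map_inj_uniq ?iota_uniq// => i j /eqP; rewrite eqr_nat => /eqP.
Qed.

(* [(t I - A) (I + t^-1 J) = t I - A + J] with [J] the all-ones matrix, whence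
   [(t + N) char_A(t) = t char_(A - J)(t)]. *)
Lemma char_poly_double_root0 (R : realType) n (A : 'M[R]_n) :
  A *m const_mx 1 = (0 : 'cV_n) ->
  'X ^+ 2 %| char_poly A -> (char_poly (A - const_mx 1)).[0] = 0.
Proof.
move=> A1 /dvdpP[q qE].
pose u : 'cV[R]_n := const_mx 1; pose v : 'rV[R]_n := const_mx 1.
have J1 : (const_mx 1 : 'M[R]_n) = u *m v.
  by apply/matrixP => i j; rewrite !mxE big_ord1 !mxE mulr1.
suff -> : char_poly (A - const_mx 1) = ('X + n%:R%:P) * q * 'X.
  by rewrite hornerMX mulr0.
apply: poly_eq_pos => t t0; apply: (mulfI (lt0r_neq0 t0)).
have t_neq0 := lt0r_neq0 t0.
rewrite (_ : t * _ = (t + n%:R) * (char_poly A).[t]); last first.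
  rewrite !horner_char_poly.
  have -> : t%:M - (A - const_mx 1) =
      (t%:M - A) *m (1%:M + (t^-1 *: u) *m v).
    rewrite mulmxDr mulmx1 -scalemxAl -scalemxAr mulmxBl.
    rewrite mul_scalar_mx mulmxA A1 mul0mx subr0 scalerA mulVf// scale1r -J1.
    by rewrite opprB addrA addrAC.
  (* Sylvester's identity reduces the determinant of the rank-one perturbation to the scalar
     [1 + n / t]. *)
  rewrite det_mulmx det_addmx_mulmx mulrCA mulrC; congr (_ * _).
  rewrite det_mx11 !mxE (eq_bigr (fun=> t^-1)); last first.
    by move=> i _; rewrite !mxE mulr1 mul1r.
  by rewrite sumr_const card_ord eqxx mulr1n -[t^-1 *+ n]mulr_natr; field.
by rewrite qE !(hornerM, hornerD, hornerC, hornerXn, hornerX); ring.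
Qed.

(** * Rayleigh quotient on the orthogonal of the constants *)

Lemma frob_trmx (R : realType) m n (A B : 'M[R]_(m, n)) :
  frob A^T B^T = frob A B.
Proof. by rewrite /frob trmxK mxtrace_mulC -mxtrace_tr trmx_mul trmxK. Qed.

Lemma frob_const1 (R : realType) n (v : 'rV[R]_n) :
  frob v (const_mx 1) = \sum_j v 0 j.
Proof.
by rewrite frobE big_ord1; apply: eq_bigr => j _; rewrite mxE mulr1.
Qed.

(** The source is any topological space and continuity is entrywise, so that the half-line with its
    subspace topology is covered too. *)
Lemma continuous_frob (R : realType) (T : topologicalType) m n
    (f g : T -> 'M[R]_(m, n)) :
  (forall i j, continuous (fun x => f x i j)) ->
  (forall i j, continuous (fun x => g x i j)) ->
  continuous (fun x => frob (f x) (g x)).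
Proof.
move=> cf cg; rewrite (_ : (fun x => _) =
    (fun x => \sum_i \sum_j f x i j * g x i j)); last first.
  by apply/funext => x; rewrite frobE.
do 2 (apply: continuous_big => [|? _]; first exact: add_continuous).
by move=> x; apply: cvgM; [exact: cf | exact: cg].
Qed.

Lemma continuous_mulmx (R : realType) (T : topologicalType) m n p
    (f : T -> 'M[R]_(m, n)) (g : T -> 'M[R]_(n, p)) :
  (forall i j, continuous (fun x => f x i j)) ->
  (forall i j, continuous (fun x => g x i j)) ->
  forall i j, continuous (fun x => (f x *m g x) i j).
Proof.
move=> cf cg i j; rewrite (_ : (fun x => _) =
    (fun x => \sum_k f x i k * g x k j)); last first.
  by apply/funext => x; rewrite mxE.
apply: continuous_big => [|k _]; first exact: add_continuous.
by move=> x; apply: cvgM; [exact: cf | exact: cg].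
Qed.

(** A first-order test at the minimum [s = 0]: for [a > 0] the expression is negative at
    [s = - a / (|k| + 1)]. *)
Lemma quad_nonneg_eq0 (R : realType) (a k : R) :
  0 <= a -> (forall s, 0 <= 2 * s * a + s ^+ 2 * k) -> a = 0.
Proof.
move=> a0 h; apply/eqP; rewrite eq_le a0 andbT leNgt; apply/negP => a_gt0.
pose k' : R := `|k| + 1; have k'0 : 0 < k' by rewrite ltr_wpDl.
have kk' : k < k' by rewrite ltr_pwDr// ler_norm.
have := h (- a / k'); rewrite leNgt => /negP; apply.
rewrite (_ : _ + _ = (a / k') ^+ 2 * (k - 2 * k')); last first.
  by field; rewrite gt_eqF.
by rewrite nmulr_llt0 ?exprn_gt0 ?divr_gt0//; lra.
Qed.

Section Rayleigh.
Context (R : realType) (N : nat) (hN : (2 <= N)%N) (A : 'M[R]_N).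
Hypotheses (Asym : A^T = A)
  (A1 : (const_mx 1 : 'rV_N) *m A = 0)
  (Age0 : forall v : 'rV_N, 0 <= frob v (v *m A))
  (Aeq0 : forall v : 'rV_N, frob v (v *m A) = 0 -> exists c, v = const_mx c).

Let frobA (u v : 'rV_N) : frob u (v *m A) = frob (u *m A) v.
Proof. by rewrite /frob trmx_mul Asym mulmxA. Qed.

Let N_neq0 : (N == 0%N) = false.
Proof. by rewrite gtn_eqF// ltnW. Qed.

Let const_ortho (c : R) : frob (const_mx c : 'rV_N) (const_mx 1) = 0 -> c = 0.
Proof.
rewrite frob_const1 (eq_bigr (fun=> c)); last by move=> j _; rewrite mxE.
rewrite sumr_const card_ord => /eqP; rewrite mulrn_eq0 N_neq0.
by move/eqP.
Qed.

(* The Rayleigh quotient attains its minimum over the orthogonal of the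
   constants, and a minimizer is an eigenvector. *)
Lemma rayleigh_eigenvector : exists (w : 'rV_N) (nu : R),
  [/\ w != 0, w *m A = nu *: w, 0 < nu &
   forall v : 'rV_N, frob v (const_mx 1) = 0 ->
     nu * frob v v <= frob v (v *m A)].
Proof.
have contid i j : continuous (fun x : 'rV[R]_N => x i j).
  exact: coord_continuous.
pose K := [set v : 'rV[R]_N | frob v v = 1] `&`
          [set v | frob v (const_mx 1) = 0].
have Kne : K !=set0.
  (* Since [2 <= N], there are two distinct basis vectors; their difference is nonzero and
     orthogonal to the constants. *)
  pose i0 := Ordinal (ltnW hN); pose i1 := Ordinal hN.
  pose v : 'rV[R]_N := delta_mx 0 i0 - delta_mx 0 i1.
  have v1 : frob v (const_mx 1) = 0.
    suff e i : frob (delta_mx 0 i : 'rV[R]_N) (const_mx 1) = 1.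
      by rewrite frobDl frobNl !e subrr.
    rewrite frob_const1 (bigD1 i)//= big1 ?addr0 => [|j /negPf jn].
      by rewrite mxE !eqxx.
    by rewrite mxE jn andbF.
  have v0 : frob v v != 0.
    apply/eqP => /frob_eq0/matrixP/(_ 0 i0).
    by rewrite !mxE !eqxx /=; move=> /eqP; rewrite subr0 oner_eq0.
  have sv : 0 < Num.sqrt (frob v v) by rewrite sqrtr_gt0 lt0r v0 frob_ge0.
  exists ((Num.sqrt (frob v v))^-1 *: v); split => /=.
    rewrite frobZl frobZr mulrA -expr2 exprVn sqr_sqrtr ?frob_ge0//.
    by rewrite mulVf.
  by rewrite frobZl v1 mulr0.
have Kc : compact K.
  apply: bounded_closed_compact.
    exists 1; split=> // x x1 v [/= v1 _].
    rewrite [`|v|]/Num.Def.normr/= mx_normrE.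
    apply/bigmax_leP; split => [|[i j] _ /=]; first lra.
    apply: le_trans (ltW x1).
    rewrite -(ler_pXn2r (n := 2)) ?nnegrE// expr1n real_normK ?num_real//.
    by rewrite -v1 frob_ge_sqr.
  apply: closedI;
    apply: (@preimage_closed _ _ (fun v : 'rV[R]_N => frob v _) [set x | x = _]).
  - by move=> x _; apply: (continuous_frob (f := id) (g := id)).
  - exact: closed_eq.
  - move=> x _; apply: (continuous_frob (f := id)) => // i j.
    exact: cst_continuous.
  - exact: closed_eq.
have qc : continuous (fun v : 'rV[R]_N => frob v (v *m A)).
  apply: continuous_frob => //; apply: continuous_mulmx => // i j.
  exact: cst_continuous.
have [w] := EVT_min_rV Kne Kc (continuous_subspaceT qc).
rewrite inE => -[/= w1 w_ortho] wmin.
pose nu := frob w (w *m A).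
have ray (v : 'rV_N) : frob v (const_mx 1) = 0 ->
    nu * frob v v <= frob v (v *m A).
  move=> v_ortho; have [v0|v0] := eqVneq (frob v v) 0.
    by rewrite v0 mulr0.
  have vv : 0 < frob v v by rewrite lt0r v0 frob_ge0.
  pose r := (Num.sqrt (frob v v))^-1.
  have r2 : r ^+ 2 = (frob v v)^-1 by rewrite exprVn sqr_sqrtr ?frob_ge0.
  have := wmin (r *: v); rewrite inE -/nu -scalemxAl !frob_lin mulrA -expr2 r2.
  rewrite mulrC ler_pdivlMr// mulrC; apply; split => /=.
    by rewrite !frob_lin mulrA -expr2 r2 mulVf.
  by rewrite frobZl v_ortho mulr0.
exists w, nu; split => //.
- by apply/eqP => w0; move: w1; rewrite w0 frob0r => /esym/eqP; rewrite oner_eq0.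
(* The residual [z] is orthogonal to the constants, so [w + s z] is an admissible competitor. Its
   Rayleigh excess has linear term [2 s |z|^2], which forces [z = 0]. *)
- have [z zE] : exists z, z = w *m A - nu *: w by eexists.
  apply/eqP; rewrite -subr_eq0 -zE; apply/eqP.
  apply/frob_eq0/(quad_nonneg_eq0 (k := frob z (z *m A) - nu * frob z z)).
    exact: frob_ge0.
  move=> s; have := ray (w + s *: z); rewrite -subr_ge0.
  have -> : frob (w + s *: z) ((w + s *: z) *m A) -
      nu * frob (w + s *: z) (w + s *: z) =
      2 * s * frob z z + s ^+ 2 * (frob z (z *m A) - nu * frob z z).
    have zz : frob z z = frob z (w *m A) - nu * frob z w.
      by rewrite -frobZr -frobNr -frobDr -zE.
    rewrite mulmxDl -scalemxAl !frob_lin (frobA w z) (frobC (w *m A)).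
    have -> : frob z (w *m A) = frob z z + nu * frob z w by rewrite zz subrK.
    by rewrite w1 (frobC w z) -/nu; ring.
  apply; rewrite frobDl frobZl w_ortho add0r zE frobDl frobNl frobZl w_ortho.
  by rewrite -frobA A1 frob0r mulr0 subr0 mulr0.
(* If [nu] were zero, [w] would be constant and orthogonal to the constants, hence zero, against its
   unit norm. *)
- rewrite lt0r Age0 andbT; apply/eqP => /Aeq0[c wc].
  move: w1 w_ortho; rewrite wc => w1 /const_ortho c0.
  move: w1; rewrite c0 (_ : const_mx 0 = 0) ?frob0r; last exact/matrixP.
  by move=> /esym/eqP; rewrite oner_eq0.
Qed.

(* The minimum [nu] is a positive eigenvalue while the head of [s] is [0], so
   [s`_1 <= nu]; [s`_1 = 0] would make [0] a double root. *)
Lemma rayleigh_second_eigenvalue (s : seq R) : ordered_eigenvalues A s ->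
  0 < s`_1 /\
  forall v : 'rV_N, frob v (const_mx 1) = 0 ->
    s`_1 * frob v v <= frob v (v *m A).
Proof.
move=> [s_sorted sE].
(* As [2 <= N], the entry of index 1 is a true eigenvalue and not the default value of [nth]. *)
have size_s : size s = N.
  by have := size_char_poly A; rewrite sE size_prod_XsubC => -[].
have roots a : (a \in s) = root (char_poly A) a by rewrite sE root_prod_XsubC.
have s_ge0 a : a \in s -> 0 <= a.
  rewrite roots -eigenvalue_root_char => /eigenvalueP[v vA v0].
  have := Age0 v; rewrite vA frobZr pmulr_lge0// lt0r frob_ge0 andbT.
  by apply/eqP => /frob_eq0 /eqP; apply/negP.
have s0 : 0 \in s.
  rewrite roots -eigenvalue_root_char; apply/eigenvalueP.
  exists (const_mx 1); first by rewrite A1 scale0r.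
  apply/eqP => /matrixP/(_ 0 (Ordinal hN)); rewrite !mxE => /eqP.
  by rewrite oner_eq0.
have [w [nu [w0 wA nu0 ray]]] := rayleigh_eigenvector.
have snu : nu \in s.
  by rewrite roots -eigenvalue_root_char; apply/eigenvalueP; exists w.
case: s s_sorted sE size_s roots s_ge0 s0 snu => [|a [|b s]] /=.
- by move=> _ _ N0; exfalso; move: hN; rewrite -N0.
- by move=> _ _ N1; exfalso; move: hN; rewrite -N1.
move=> /andP[ab bs] sE _ _ s_ge0 s0 snu.
have b_le x : x \in b :: s -> b <= x.
  rewrite inE => /orP[/eqP -> //|xs].
  by move: bs; rewrite (path_sortedE le_trans) => /andP[/allP/(_ _ xs)].
have a0 : a = 0.
  apply/eqP; rewrite eq_le s_ge0 ?mem_head// andbT.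
  by move: s0; rewrite inE => /orP[/eqP -> //|/b_le]; apply: le_trans.
have b_nu : b <= nu.
  by apply: b_le; move: snu; rewrite inE a0 (gt_eqF nu0).
have b0 : 0 < b.
  rewrite lt0r s_ge0 ?andbT ?inE ?eqxx ?orbT//; apply/eqP => b0.
  have : root (char_poly (A - const_mx 1)) 0.
    apply/rootP/char_poly_double_root0.
      by apply: trmx_inj; rewrite trmx_mul Asym trmx_const A1 trmx0.
    by rewrite sE !big_cons a0 b0 subr0 mulrA -expr2 dvdp_mulr.
  (* An eigenvector [v] for 0 satisfies [v A = v E] with [E] the all-ones matrix. Multiplying by the
     ones vector gives [v] orthogonal to it, so [v A = v E = 0]. Then [v] is also constant, hence
     zero. *)
  rewrite -eigenvalue_root_char => /eigenvalueP[v vA /eqP]; apply.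
  rewrite scale0r mulmxBr in vA; move/eqP: vA; rewrite subr_eq0 => /eqP vA.
  have v1 : frob v (const_mx 1) = 0.
    have : v *m A *m const_mx 1 = 0 :> 'M[R]_1.
      rewrite -mulmxA (_ : A *m _ = 0) ?mulmx0//.
      by apply: trmx_inj; rewrite trmx_mul Asym trmx_const A1 trmx0.
    rewrite vA => /matrixP/(_ 0 0); rewrite !mxE.
    rewrite (eq_bigr (fun=> frob v (const_mx 1))) => [/eqP|j _].
      rewrite sumr_const card_ord mulrn_eq0 N_neq0.
      by move/eqP.
    by rewrite !mxE mulr1 frob_const1; apply: eq_bigr => k _; rewrite mxE mulr1.
  have [|c vc] := Aeq0 (v := v).
    rewrite vA (_ : v *m _ = 0) ?frob0r//; apply/matrixP => i j.
    rewrite !mxE ord1 -[RHS]v1 frob_const1; apply: eq_bigr => k _.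
    by rewrite mxE mulr1.
  move: v1; rewrite vc => /const_ortho ->; exact/matrixP.
split=> // v v1; apply: le_trans (ray _ v1).
by rewrite ler_wpM2r ?frob_ge0.
Qed.

End Rayleigh.

(** * Spectral gap of the Laplacian *)

Section Laplacian.
Context (R : realType) (N : nat) (G : wdigraph R N).
Local Notation L := (laplacian G).

Lemma laplacian_mulmx n (X : 'M[R]_(N, n)) i k :
  (L *m X) i k = \sum_j adj G i j * (X i k - X j k).
Proof.
rewrite mulmxBl mxE mul_diag_mx !mxE mulr_suml -sumrB.
by apply: eq_bigr => j _; rewrite mulrBr.
Qed.

Lemma laplacian_const n (u : 'rV[R]_n) : L *m (const_mx 1 *m u) = 0.
Proof.
apply/matrixP => i k; rewrite laplacian_mulmx big1 ?mxE// => j _.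
by rewrite !mxE !big_ord1 !mxE subrr mulr0.
Qed.

Hypothesis hwb : weight_balanced G.

(** Weight balance makes the columns of the Laplacian sum to zero, as its rows always do. This is
    the source of the conservation of the sum of the [eta i]. *)
Lemma const_laplacian : (const_mx 1 : 'rV_N) *m L = 0.
Proof.
rewrite mulmxBr; apply/matrixP => i j; rewrite mul_mx_diag !mxE mul1r hwb.
by rewrite -sumrB big1// => k _; rewrite mxE mul1r subrr.
Qed.

(** The Dirichlet form of the graph: by balance, the squares weighted by row sums and by column sums
    have equal totals, which completes the square. *)
Lemma laplacian_quad (v : 'rV[R]_N) :
  frob v (v *m L) = 2^-1 * \sum_i \sum_j adj G i j * (v 0 i - v 0 j) ^+ 2.
Proof.
have sq : \sum_i \sum_j adj G i j * v 0 i ^+ 2 =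
          \sum_i \sum_j adj G i j * v 0 j ^+ 2.
  rewrite [RHS]exchange_big/=; apply: eq_bigr => i _.
  by rewrite -!mulr_suml hwb.
have -> : frob v (v *m L) = \sum_i \sum_j adj G i j * v 0 i ^+ 2 -
                            \sum_i \sum_j adj G i j * (v 0 i * v 0 j).
  rewrite mulmxBr frobDr frobNr; congr (_ - _); rewrite frobE big_ord1.
    apply: eq_bigr => i _; rewrite mul_mx_diag !mxE -mulr_suml.
    by rewrite mulrA -expr2 mulrC.
  rewrite [RHS]exchange_big/=; apply: eq_bigr => j _.
  by rewrite mxE mulr_sumr; apply: eq_bigr => i _; ring.
rewrite (_ : \sum_i \sum_j adj G i j * (v 0 i - v 0 j) ^+ 2 =
  \sum_i \sum_j adj G i j * v 0 i ^+ 2 + \sum_i \sum_j adj G i j * v 0 j ^+ 2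
  - 2 * \sum_i \sum_j adj G i j * (v 0 i * v 0 j)); first by rewrite -sq; field.
rewrite mulr_sumr -big_split/= -sumrB; apply: eq_bigr => i _.
rewrite mulr_sumr -big_split/= -sumrB; apply: eq_bigr => j _.
by ring.
Qed.

Lemma adj_ge0 i j : 0 <= adj G i j.
Proof.
by have [/adj_gt0/ltW//|/adj_eq0 ->] := boolP (edge G i j).
Qed.

Let A := 2^-1 *: (L + L^T).

Let frob_sym (v : 'rV[R]_N) : frob v (v *m A) = frob v (v *m L).
Proof.
rewrite -scalemxAr mulmxDr frobZr frobDr.
have -> : frob v (v *m L^T) = frob v (v *m L).
  by rewrite [RHS]frobC /frob trmx_mul trmxK mulmxA.
by field.
Qed.

(** The symmetric part has the same quadratic form as [L]. Where this form vanishes, [v] agrees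
    along every edge, hence everywhere by strong connectivity, so the Rayleigh section applies.
    Matrices [X] are treated column by column. *)
Lemma laplacian_spectral_gap (hN : (2 <= N)%N) (hsc : strongly_connected G)
    (s : seq R) (hs : ordered_eigenvalues (2^-1 *: (L + L^T)) s) :
  0 < s`_1 /\ forall n (X : 'M[R]_(N, n)), (const_mx 1 : 'rV_N) *m X = 0 ->
    s`_1 * frob X X <= frob X (L *m X).
Proof.
have A1 : (const_mx 1 : 'rV_N) *m A = 0.
  rewrite -scalemxAr mulmxDr const_laplacian add0r; apply: trmx_inj.
  rewrite linearZ/= trmx_mul trmxK trmx_const trmx0.
  have := laplacian_const (const_mx 1 : 'rV_1).
  rewrite (_ : _ *m const_mx 1 = const_mx 1) => [->|].
    by rewrite scaler0.
  by apply/matrixP => i j; rewrite !mxE big_ord1 !mxE mulr1.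
have Asym : A^T = A by rewrite linearZ linearD /= trmxK addrC.
have quad_ge0 (v : 'rV_N) i j : 0 <= adj G i j * (v 0 i - v 0 j) ^+ 2.
  by rewrite mulr_ge0 ?adj_ge0 ?sqr_ge0.
have Age0 (v : 'rV_N) : 0 <= frob v (v *m A).
  rewrite frob_sym laplacian_quad mulr_ge0 ?invr_ge0//.
  by do 2 (apply: sumr_ge0 => ? _).
have Aeq0 (v : 'rV_N) : frob v (v *m A) = 0 -> exists c, v = const_mx c.
  rewrite frob_sym laplacian_quad => /eqP.
  rewrite mulf_eq0 invr_eq0 pnatr_eq0/= psumr_eq0; last first.
    by move=> i _; exact: sumr_ge0.
  move=> /allP v0; have edge_eq i j : edge G i j -> v 0 i = v 0 j.
    move=> ij; have := v0 i (mem_index_enum i).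
    rewrite /= psumr_eq0// => /allP/(_ j (mem_index_enum j)).
    by rewrite mulf_eq0 (gt_eqF (adj_gt0 ij)) sqrf_eq0 subr_eq0 => /eqP.
  have conn i j : v 0 i = v 0 j.
    have /connectP[p] := hsc i j; elim: p i => [|k p IH] i /=.
      by move=> _ ->.
    by move=> /andP[/edge_eq -> kp] /(IH _ kp).
  exists (v 0 (Ordinal (ltnW hN))); apply/rowP => j; rewrite mxE; exact: conn.
have [s0 ray] := rayleigh_second_eigenvalue hN Asym A1 Age0 Aeq0 hs.
split=> // n X X1; rewrite !frob_col mulr_sumr; apply: ler_sum => j _.
have /ray : frob (col j X)^T (const_mx 1) = 0.
  rewrite frob_const1; move: X1 => /matrixP/(_ 0 j); rewrite !mxE => h.
  rewrite -[RHS]h.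
  by apply: eq_bigr => i _; rewrite !mxE mul1r.
rewrite frob_trmx frob_sym => h; apply: le_trans h _.
rewrite (_ : col j (L *m X) = L *m col j X); last by rewrite !colE mulmxA.
by rewrite /frob !trmx_mul trmxK mxtrace_mulC -mulmxA mxtrace_mulC mulmxA.
Qed.

End Laplacian.

(** * Strongly convex functions and the optimum *)

Lemma dotvE (R : realType) n (u v : 'rV[R]_n) : dotv u v = frob u v.
Proof. by rewrite frobE big_ord1. Qed.

Lemma derive_grad (R : realType) n (f : 'rV[R]_n -> R) (u v : 'rV[R]_n) :
  differentiable f u -> 'D_v f u = frob (grad f u) v.
Proof.
move=> df; rewrite deriveE// frobE big_ord1 [in LHS](row_sum_delta v).
rewrite linear_sum; apply: eq_bigr => j _.
by rewrite linearZ/= mxE deriveE// mulrC.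
Qed.

Lemma is_derive_line (R : realType) n (f : 'rV[R]_n -> R) (u v : 'rV[R]_n) s :
  differentiable f (u + s *: v) ->
  is_derive s (1 : R) (fun s => f (u + s *: v)) (frob (grad f (u + s *: v)) v).
Proof.
move=> df; rewrite -derive_grad//.
have fE : (fun h : R => h^-1 *: ((fun s => f (u + s *: v)) (h *: 1 + s)
             - f (u + s *: v))) =
          (fun h => h^-1 *: (f (h *: v + (u + s *: v)) - f (u + s *: v))).
  apply/funext => h; congr (_ *: (f _ - _)).
  by rewrite [h *: 1]mulr1 scalerDl addrCA.
have dfv : derivable f (u + s *: v) v by exact: diff_derivable.
split; rewrite /derivable /derive /= fE//.
Qed.

Section StronglyConvex.
Context (R : realType) (n : nat) (w : R) (f : 'rV[R]_n -> R).
Hypothesis df : forall u, differentiable f u.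
Hypothesis cvx : strongly_convex w f.

Lemma strongly_convex_frob (u v : 'rV[R]_n) :
  w * frob (u - v) (u - v) <= frob (u - v) (grad f u - grad f v).
Proof. by rewrite -enorm_sqr -dotvE; exact: cvx. Qed.

(** Along the segment from [u] to [u + v], let [g] be [f] minus the non-constant part of the
    minorant. Strong convexity between [u + s v] and [u], divided by [s], makes its derivative
    nonnegative. *)
Lemma strongly_convex_lower (u v : 'rV[R]_n) :
  f u + frob (grad f u) v + w / 2 * frob v v <= f (u + v).
Proof.
pose g := fun s : R => f (u + s *: v) - (s * frob (grad f u) v
                                        + s ^+ 2 * (w / 2 * frob v v)).
pose g' := fun s : R => frob (grad f (u + s *: v) - grad f u) v
                         - s * (w * frob v v).
have dg (s : R) : is_derive s 1 g (g' s).
  have dl := is_derive_line (df (u + s *: v)).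
  apply: is_derive_eq.
  rewrite /g' frobDl frobNl /GRing.scale/=; by field.
have cg : {within `[0, 1], continuous g}.
  by apply: derivable_within_continuous => r _; have [] := dg r.
have g01 : g 0 <= g 1.
  apply: (@ger0_derive1_ndecr _ g 0 1) => //.
  - move=> s; rewrite in_itv/= => /andP[s0 _].
    rewrite derive1E (@derive_val _ _ _ _ _ _ _ (dg s)) /g' subr_ge0.
    have := strongly_convex_frob (u + s *: v) u.
    rewrite addrAC subrr add0r frobZl frobZr frobZl.
    by rewrite mulrCA ler_pM2l// mulrCA [leRHS]frobC.
move: g01; rewrite /g scale0r addr0 scale1r; lra.
Qed.
End StronglyConvex.

Lemma continuous_mx (R : realType) (T : topologicalType) m n
    (f : T -> 'M[R]_(m, n)) :
  (forall i j, continuous (fun x => f x i j)) -> continuous f.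
Proof.
move=> cf x A [P Pn PA]; apply: filterS PA _.
apply: filter_forall => i; apply: filter_forall => j.
exact: cf (Pn i j).
Qed.

(** Young's inequality with weight [w / 4] absorbs the linear term into half of the quadratic
    one. *)
Lemma strongly_convex_coercive (R : realType) n (w : R) (f : 'rV[R]_n -> R) v :
  0 < w -> (forall u, differentiable f u) -> strongly_convex w f ->
  f 0 - frob (grad f 0) (grad f 0) / w + w / 4 * frob v v <= f v.
Proof.
move=> w0 df cvx; have := strongly_convex_lower df cvx 0 v; rewrite add0r.
apply: le_trans.
have w4 : 0 < w / 4 by lra.
have := frob_young v (- grad f 0) w4.
rewrite !frob_lin opprK (_ : 4 * (w / 4) = w); last by field.
by rewrite (frobC v); lra.
Qed.

(** * Existence, first-order condition and uniqueness of the optimum *)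

Section Optimum.
Context (R : realType) (N n : nat) (d : 'I_N -> 'rV[R]_n)
  (f : 'I_N -> 'rV[R]_n -> R) (w : R).
Hypotheses (w0 : 0 < w) (df : forall i u, differentiable (f i) u)
  (cvx : forall i, strongly_convex w (f i)).

(** The extreme value theorem on the feasible part of a sublevel set, bounded by coercivity. Points
    are flattened to rows of length [N * n], the form taken by [EVT_min_rV]. *)
Lemma optimal_exists : exists x, optimal f d x.
Proof.
pose X (u : 'rV[R]_(N * n)) i : 'rV[R]_n := row i (vec_mx u).
pose F u := \sum_i f i (X u i).
pose c := mxvec (\matrix_i d i).
have Xmx (y : 'I_N -> 'rV[R]_n) i : X (mxvec (\matrix_i y i)) i = y i.
  by rewrite /X mxvecK rowK.
have XE u i j : X u i 0 j = u 0 (mxvec_index i j) by rewrite !mxE.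
(* The point [c] stacks the [d i] and is feasible. Writing feasibility as a vanishing squared norm
   presents it as a closed preimage. *)
pose K := [set u | F u <= F c] `&`
  [set u | frob (\sum_i X u i - \sum_i d i) (\sum_i X u i - \sum_i d i) = 0].
have feasE u : (frob (\sum_i X u i - \sum_i d i) (\sum_i X u i - \sum_i d i) = 0)
    <-> feasible d (X u).
  split=> [/frob_eq0/eqP|fe]; first by rewrite subr_eq0 => /eqP.
  by rewrite fe subrr frob0r.
have cX i : continuous (X ^~ i).
  apply: continuous_mx => k j.
  rewrite (_ : (fun u => _) = (fun u : 'rV[R]_(N * n) => u 0 (mxvec_index i j))).
    exact: coord_continuous.
  by apply/funext => u; rewrite ord1 XE.
have cF : continuous F.
  apply: continuous_big => [|i _]; first exact: add_continuous.
  move=> u; apply: (@continuous_comp _ _ _ (X ^~ i) (f i)); first exact: cX.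
  exact/differentiable_continuous/df.
have Kne : K !=set0.
  exists c; split => //=; apply/feasE; rewrite /feasible.
  by apply: eq_bigr => i _; rewrite Xmx.
pose C := \sum_i (f i 0 - frob (grad (f i) 0) (grad (f i) 0) / w).
have FC u : C + w / 4 * frob u u <= F u.
  have -> : frob u u = \sum_i frob (X u i) (X u i).
    rewrite frobE big_ord1 (reindex _ (curry_mxvec_bij _ _)) /=.
    under [RHS]eq_bigr do rewrite frobE big_ord1.
    by rewrite pair_bigA; apply: eq_bigr => -[i j] _; rewrite /= !XE.
  rewrite mulr_sumr -big_split/=; apply: ler_sum => i _.
  exact: strongly_convex_coercive.
have Kc : compact K.
  apply: bounded_closed_compact.
    (* Coercivity bounds [|u|^2] by [4 / w * (F c - C)], and [2 |t| <= 1 + t^2] passes from squares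
       to entries. *)
    exists (1 + 4 / w * (F c - C)); split; first exact: num_real.
    move=> x hx u [/= uc _].
    have uu : frob u u <= 4 / w * (F c - C).
      rewrite mulrAC ler_pdivlMr//; have := FC u; lra.
    rewrite [`|u|]/Num.Def.normr/= mx_normrE.
    have x1 : 1 + frob u u < x by lra.
    have := frob_ge0 u => u0.
    apply/bigmax_leP; split => [|[i j] _ /=]; first lra.
    apply: le_trans (ltW x1); have := frob_ge_sqr u i j.
    have := sqr_ge0 (`|u i j| - 1); rewrite sqrrB real_normK ?num_real//.
    by rewrite expr1n mulr1; lra.
  apply: closedI.
    apply: (@preimage_closed _ _ F [set x | x <= F c]); last exact: closed_le.
    by move=> u _; exact: cF.
  apply: (@preimage_closed _ _ (fun u => frob _ _) [set x | x = 0]); last exact: closed_eq.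
  have cg i j : continuous (fun u => (\sum_i X u i - \sum_i d i) i j).
    rewrite (_ : (fun u => _) = (fun u : 'rV[R]_(N * n) =>
      \sum_k u 0 (mxvec_index k j)) + cst (- (\sum_k d k) 0 j)).
      move=> u; apply: continuousD; last exact: cst_continuous.
      apply: continuous_big => [|k _]; first exact: add_continuous.
      exact: coord_continuous.
    apply/funext => u; rewrite ord1 !mxE summxE; congr (_ + _).
    by apply: eq_bigr => k _; rewrite XE.
  by move=> u _; exact: continuous_frob.
have [u] := EVT_min_rV Kne Kc (continuous_subspaceT cF).
rewrite inE => -[/= uF /feasE uf] umin.
exists (X u); split=> // y yf.
(* A competitor outside the sublevel set costs more than [c], which costs at least as much as
   [u]. *)
have [yF|yF] := leP (F (mxvec (\matrix_i y i))) (F c).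
  have := umin (mxvec (\matrix_i y i)).
  rewrite inE {2}/F; under eq_bigr do rewrite Xmx.
  apply; split => //=; apply/feasE; rewrite /feasible.
  by under eq_bigr do rewrite Xmx.
apply: (le_trans uF); apply: (le_trans (ltW yF)).
by rewrite /F; under eq_bigr do rewrite Xmx.
Qed.

(** The Lagrange condition: moving [s e] from agent [k] to agent [i] preserves feasibility, so the
    cost [g] of the two agents is minimal at [s = 0] and its derivative vanishes there. *)
Lemma optimal_grad x i k : optimal f d x -> grad (f i) (x i) = grad (f k) (x k).
Proof.
move=> [xf xmin]; have [-> //|ik] := eqVneq i k.
apply/rowP => j; pose e : 'rV[R]_n := 'e_j.
pose g := (fun s : R => f i (x i + s *: e)) + (fun s => f k (x k + s *: - e)).
have gE s : g s = f i (x i + s *: e) + f k (x k + s *: - e) by [].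
have dg (s : R) : is_derive s 1 g
    (frob (grad (f i) (x i + s *: e)) e + frob (grad (f k) (x k + s *: - e)) (- e)).
  apply: is_deriveD; exact: is_derive_line.
have /(@derive_val _ _ _ _ _ _ _) : is_derive (0 : R) 1 g 0.
  apply: (@derive1_at_min _ g (- 1) 1); first by lra.
  - by move=> t _; have [] := dg t.
  - by rewrite in_itv/=; lra.
  move=> s _.
  pose y l := if l == i then x i + s *: e
              else if l == k then x k + s *: - e else x l.
  have split_sum (V : zmodType) (h : 'I_N -> V) :
      \sum_l h l = h i + h k + \sum_(l | (l != i) && (l != k)) h l.
    by rewrite (bigD1 i)//= (bigD1 k)/= ?addrA// eq_sym.
  have yi : y i = x i + s *: e by rewrite /y eqxx.
  have yk : y k = x k + s *: - e by rewrite /y eq_sym (negPf ik) eqxx.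
  have yf : feasible d y.
    rewrite /feasible -xf !split_sum yi yk scalerN addrACA subrr addr0.
    congr (_ + _); apply: eq_bigr => l /andP[li lk].
    by rewrite /y (negPf li) (negPf lk).
  have := xmin y yf; rewrite !split_sum yi yk !gE !scale0r !addr0.
  rewrite [X in _ <= _ + X](_ : _ = \sum_(l | (l != i) && (l != k)) f l (x l)).
    by rewrite lerD2r.
  by apply: eq_bigr => l /andP[li lk]; rewrite /y (negPf li) (negPf lk).
rewrite (@derive_val _ _ _ _ _ _ _ (dg 0)) !scale0r !addr0 frobNr.
have frob_e (v : 'rV[R]_n) : frob v e = v 0 j.
  rewrite frobE big_ord1 (bigD1 j)//= big1 ?addr0 => [|l /negPf lj].
    by rewrite mxE !eqxx mulr1.
  by rewrite mxE lj andbF mulr0.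
by rewrite !frob_e => /eqP; rewrite subr_eq0 => /eqP.
Qed.

(** At each optimum all agents share one gradient. Summing strong monotonicity therefore pairs a
    fixed vector with [\sum_i (y i - x i)], which is zero. *)
Lemma optimal_unique x y : optimal f d x -> optimal f d y -> y =1 x.
Proof.
move=> ox oy i0.
have xy : \sum_i w * frob (y i - x i) (y i - x i) <= 0.
  apply: (@le_trans _ _ (\sum_i frob (y i - x i)
     (grad (f i0) (y i0) - grad (f i0) (x i0)))).
    apply: ler_sum => i _; rewrite (optimal_grad i0 i ox) (optimal_grad i0 i oy).
    exact: strongly_convex_frob.
  have [[xf _] [yf _]] := (ox, oy).
  rewrite /frob -(raddf_sum (@mxtrace R 1)) -mulmx_suml sumrB xf yf subrr.
  by rewrite mul0mx raddf0.
have : w * frob (y i0 - x i0) (y i0 - x i0) <= 0.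
  apply: le_trans xy; rewrite (bigD1 i0)//= lerDl.
  by apply: sumr_ge0 => i _; rewrite mulr_ge0 ?frob_ge0// ltW.
rewrite pmulr_rle0// => yx; apply/eqP; rewrite -subr_eq0; apply/eqP/frob_eq0.
by apply/eqP; rewrite eq_le yx frob_ge0.
Qed.

End Optimum.

(** * Lyapunov decay *)

Lemma is_derive_frob (R : realType) m n (A B : R -> 'M[R]_(m, n))
    (A' B' : 'M[R]_(m, n)) (t : R) :
  (forall i j, is_derive t (1 : R) (fun s => A s i j) (A' i j)) ->
  (forall i j, is_derive t (1 : R) (fun s => B s i j) (B' i j)) ->
  is_derive t (1 : R) (fun s => frob (A s) (B s)) (frob A' (B t) + frob (A t) B').
Proof.
move=> dA dB.
have dAB i j : is_derive t (1 : R) (fun s => A s i j * B s i j)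
    (A' i j * B t i j + A t i j * B' i j).
  apply: is_derive_eq; rewrite /GRing.scale/=; ring.
rewrite (_ : (fun s => _) = (\sum_i \sum_j (fun s => A s i j * B s i j))).
  rewrite !frobE -big_split/=.
  rewrite (eq_bigr (fun i => \sum_j (A' i j * B t i j + A t i j * B' i j))).
    by apply: is_derive_sum => i; exact: is_derive_sum.
  by move=> i _; rewrite -big_split.
apply/funext => s; rewrite frobE fct_sumE; apply: eq_bigr => i _.
by rewrite fct_sumE.
Qed.

(** Grönwall's argument: [U s * expR (c * s)] is nonincreasing. The case [c = 0] later yields a
    conservation law. *)
Lemma exp_decay (R : realType) (U U' : R -> R) (c : R) :
  {within `[0, +oo[, continuous U} ->
  (forall t : R, 0 < t -> is_derive t (1 : R) U (U' t)) ->
  (forall t : R, 0 < t -> U' t <= - c * U t) ->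
  forall t : R, 0 <= t -> U t <= U 0 * expR (- c * t).
Proof.
move=> cU dU U'le t t0.
pose g s := U s * expR (c * s).
have dg (s : R) : 0 < s -> is_derive s (1 : R) g ((U' s + c * U s) * expR (c * s)).
  move=> s0; have ? := dU _ s0.
  have ? : is_derive s (1 : R) (fun s => expR (c * s)) (c * expR (c * s)).
    have dc : is_derive s (1 : R) (fun s => c * s) c.
      by apply: is_derive_eq; rewrite /GRing.scale/=; ring.
    by rewrite [c * _]mulrC; exact: (is_derive1_comp (is_derive_expR _) dc).
  by apply: is_derive_eq; rewrite /GRing.scale/=; ring.
have : g t <= g 0.
  apply: (@ler0_derive1_nincry _ g 0) => //.
  - by move=> s; rewrite in_itv/= andbT => s0; have [] := dg _ s0.
  - move=> s; rewrite in_itv/= andbT => s0.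
    rewrite derive1E (@derive_val _ _ _ _ _ _ _ (dg _ s0)).
    have := U'le _ s0 => h; rewrite pmulr_lle0 ?expR_gt0//; lra.
  - have cE : continuous (fun s : R => expR (c * s)).
      move=> r; apply: continuous_comp; first exact: mulrl_continuous.
      exact: continuous_expR.
    have cE' := continuous_subspaceT cE (A := `[(0 : R), +oo[).
    move=> s; exact: (continuousM (cU s) (cE' s)).
rewrite /g mulr0 expR0 mulr1 mulNr expRN => h.
by rewrite ler_pdivlMr ?expR_gt0.
Qed.

(** The projection [J]: multiplication on the left replaces every row by the mean of the rows. *)
Definition mean_mx (R : realType) (N : nat) : 'M[R]_N := const_mx N%:R^-1.

Lemma tr_mean_mx (R : realType) N : (mean_mx R N)^T = mean_mx R N.
Proof. exact: trmx_const. Qed.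

(** The rank-one form through which facts about constant vectors transfer to [J]. *)
Lemma mean_mx_factor (R : realType) N :
  mean_mx R N = (const_mx 1 : 'cV_N) *m (N%:R^-1 *: const_mx 1 : 'rV_N).
Proof. by apply/matrixP => i j; rewrite !mxE big_ord1 !mxE mulr1 mul1r. Qed.

Lemma const_mean_mx (R : realType) N : (0 < N)%N ->
  (const_mx 1 : 'rV_N) *m mean_mx R N = const_mx 1.
Proof.
move=> N0; apply/matrixP => i j; rewrite !mxE.
rewrite (eq_bigr (fun=> N%:R^-1)) => [|k _]; last by rewrite !mxE mul1r.
by rewrite sumr_const card_ord -[_ *+ N]mulr_natr mulVf// pnatr_eq0 -lt0n.
Qed.

Lemma mean_mx_eq0 (R : realType) N n (X : 'M[R]_(N, n)) :
  (const_mx 1 : 'rV_N) *m X = 0 -> mean_mx R N *m X = 0.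
Proof.
by move=> X0; rewrite mean_mx_factor -mulmxA -scalemxAl X0 scaler0 mulmx0.
Qed.

Lemma mean_mx_idem (R : realType) N : (0 < N)%N ->
  mean_mx R N *m mean_mx R N = mean_mx R N.
Proof.
by move=> N0; rewrite {1 3}mean_mx_factor -mulmxA -scalemxAl const_mean_mx.
Qed.

Lemma frob_mean_mx (R : realType) N n (A B : 'M[R]_(N, n)) :
  frob A (mean_mx R N *m B) = frob (mean_mx R N *m A) B.
Proof. by rewrite frob_mulmxr tr_mean_mx. Qed.

Lemma frob_mean_sqr (R : realType) N n (A : 'M[R]_(N, n)) : (0 < N)%N ->
  frob A (mean_mx R N *m A) = frob (mean_mx R N *m A) (mean_mx R N *m A).
Proof. by move=> N0; rewrite [RHS]frob_mean_mx mulmxA mean_mx_idem// frobC. Qed.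

(** * The Lyapunov function and its dissipation inequality *)

Section Lyapunov.
Context (R : realType) (N n : nat) (L : 'M[R]_N)
  (lam sigma w theta k1 k2 k3 : R).
Hypotheses (N0 : (0 < N)%N)
  (L1 : forall u : 'rV[R]_n, L *m (const_mx 1 *m u) = 0)
  (oneL : (const_mx 1 : 'rV_N) *m L = 0)
  (lam0 : 0 < lam)
  (Lgap : forall X : 'M[R]_(N, n), (const_mx 1 : 'rV_N) *m X = 0 ->
    lam * frob X X <= frob X (L *m X))
  (Lnorm : forall X : 'M[R]_(N, n),
    frob (L *m X) (L *m X) <= sigma ^+ 2 * frob X X)
  (w0 : 0 < w)
  (hk1 : sigma ^+ 2 * (w + 1) / (lam * w ^+ 2) + theta ^+ 2 / (2 * w) < k1)
  (k1_gt1 : 1 < k1) (hk2 : k1 ^+ 2 / lam ^+ 2 < k2) (k3_gt0 : 0 < k3).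

Local Notation J := (mean_mx R N).

Definition lyap (eps : R) (X M H : 'M[R]_(N, n)) : R :=
  k1 / 2 * frob X X + 2^-1 * frob M M + (2 * k3)^-1 * frob H H
  - eps * frob X (J *m M).

(** The derivative of [lyap] for arguments with derivatives [X'], [M'], [H'] (see [is_derive_lyap]),
    kept algebraic so that the estimates involve no trajectory. *)
Definition lyap_rate (eps : R) (X M H X' M' H' : 'M[R]_(N, n)) : R :=
  k1 * frob X X' + frob M M' + k3^-1 * frob H H'
  - eps * (frob X' (J *m M) + frob X (J *m M')).

(** From [J H = 0], [J L = 0] and [L J = 0], only [Q = M - J M] meets [H] and [L], and [J M']
    reduces to [- k1 J X]. *)
Lemma lyap_rateE eps (X M H G : 'M[R]_(N, n)) :
  (const_mx 1 : 'rV_N) *m H = 0 ->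
  lyap_rate eps X M H (- G + M) (k1 *: (H - X) - k2 *: (L *m M))
    (- (k3 *: (L *m (H - X)))) =
  - k1 * frob X G + k1 * frob (M - J *m M) H
  - k2 * frob (M - J *m M) (L *m (M - J *m M))
  - frob H (L *m H) + frob H (L *m X)
  + eps * frob G (J *m M) - eps * frob (J *m M) (J *m M)
  + eps * k1 * frob (J *m X) (J *m X).
Proof.
move=> H0; have JH : J *m H = 0 by exact: mean_mx_eq0.
have JL : J *m L = 0 by rewrite mean_mx_eq0.
have LJM : L *m (J *m M) = 0 by rewrite mean_mx_factor -mulmxA L1.
have fJMH : frob (J *m M) H = 0 by rewrite -frob_mean_mx JH frob0r.
have fJML : frob (J *m M) (L *m M) = 0.
  by rewrite -frob_mean_mx mulmxA JL mul0mx frob0r.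
have JM' : J *m (k1 *: (H - X) - k2 *: (L *m M)) = - (k1 *: (J *m X)).
  rewrite mulmxBr -!scalemxAr mulmxA JL mul0mx scaler0 subr0 mulmxBr JH.
  by rewrite sub0r scalerN.
have LQ : L *m (M - J *m M) = L *m M by rewrite mulmxBr LJM subr0.
rewrite /lyap_rate JM' LQ mulmxBr !frob_lin fJMH fJML.
rewrite (frob_mean_sqr X N0) (frob_mean_sqr M N0) (frobC X M).
by field; rewrite gt_eqF.
Qed.

Lemma lyap_dissipation : exists eps c : R, 0 < c /\
  forall X M H G : 'M[R]_(N, n), (const_mx 1 : 'rV_N) *m H = 0 ->
    w * frob X X <= frob X G -> frob G G <= theta ^+ 2 * frob X X ->
    4^-1 * frob X X <= lyap eps X M H /\
    lyap_rate eps X M H (- G + M) (k1 *: (H - X) - k2 *: (L *m M))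
      (- (k3 *: (L *m (H - X)))) <= - c * lyap eps X M H.
Proof.
(* The decay of [|X|^2] left after paying for [<H, L X>]; it is positive by [hk1] multiplied by
   [w]. *)
pose kappa := k1 * w - sigma ^+ 2 / lam.
have kappa0 : 0 < kappa.
  have h : (sigma ^+ 2 * (w + 1) / (lam * w ^+ 2) + theta ^+ 2 / (2 * w)) * w
      < k1 * w by rewrite ltr_pM2r.
  rewrite subr_gt0; apply: le_lt_trans h.
  rewrite (_ : _ * w = sigma ^+ 2 / lam + sigma ^+ 2 / (lam * w) + theta ^+ 2 / 2).
    rewrite -addrA lerDl addr_ge0// ?divr_ge0 ?sqr_ge0// mulr_ge0// ltW//.
  by field; rewrite !gt_eqF.
(* The cost of the [eps] terms in [|X|^2] is [eps * b]: [theta^2 / 2] comes from [<G, J M>] and [k1]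
   from [|J X|^2]. *)
pose b := theta ^+ 2 / 2 + k1.
have k1_0 : 0 < k1 := lt_trans ltr01 k1_gt1.
have b0 : 0 < b by rewrite ltr_wpDl// divr_ge0// sqr_ge0.
(* The bound [1 / 2] keeps [lyap] positive, and the other one spends at most half of [kappa]. *)
pose eps := Num.min (2^-1) (kappa / (2 * b)).
have eps0 : 0 < eps by rewrite lt_min invr_gt0 ltr0n divr_gt0// mulr_gt0.
have eps12 : eps <= 2^-1 by rewrite ge_min lexx.
have epsb : eps * b <= kappa / 2.
  have : eps <= kappa / (2 * b) by rewrite ge_min lexx orbT.
  by rewrite invfM mulrA ler_pdivlMr.
(* The least of the decay coefficients of [|X|^2], [|Q|^2], [|H|^2] and [|J M|^2]. *)
pose delta := Num.min (Num.min (kappa / 2) (k2 * lam / 2))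
                      (Num.min (lam / 4) (eps / 2)).
have k2_gt : k1 ^+ 2 < k2 * lam ^+ 2 by rewrite -ltr_pdivrMr ?exprn_gt0.
have k2_gt0 : 0 < k2 by apply: le_lt_trans hk2; rewrite divr_ge0 ?sqr_ge0.
have delta0 : 0 < delta.
  rewrite !lt_min !divr_gt0// mulr_gt0//.
(* [lyap] is at most [K] times the sum of those four squares, whence the rate [delta / K]. *)
pose K := k1 + 1 + k3^-1.
have k3V : 0 < k3^-1 by rewrite invr_gt0.
have K0 : 0 < K by rewrite !addr_gt0.
exists eps, (delta / K); split; first exact: divr_gt0.
move=> X M H G H0 XG GX.
rewrite lyap_rateE// /lyap.
have Q1 : (const_mx 1 : 'rV_N) *m (M - J *m M) = 0.
  by rewrite mulmxBr mulmxA const_mean_mx// subrr.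
have MQ : frob M M = frob (M - J *m M) (M - J *m M) + frob (J *m M) (J *m M).
  rewrite !frob_lin (frob_mean_sqr M N0) (frobC (J *m M) M) (frob_mean_sqr M N0).
  by ring.
have JX : frob (J *m X) (J *m X) <= frob X X.
  have := frob_ge0 (X - J *m X).
  rewrite !frob_lin (frobC (J *m X) X) (frob_mean_sqr X N0); lra.
have XJM1 := @frob_young R N n (2^-1) X (J *m M) ltac:(by rewrite invr_gt0).
have XJM2 := @frob_young R N n (2^-1) X (- (J *m M)) ltac:(by rewrite invr_gt0).
have GJM := @frob_young R N n (2^-1) G (J *m M) ltac:(by rewrite invr_gt0).
have HLX := @frob_young R N n (lam / 4) H (L *m X) ltac:(by rewrite divr_gt0).
(* With this weight [k1 <Q, H>] costs half of [k2 * lam * |Q|^2] and [k1^2 / (2 k2 lam) * |H|^2],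
   where the last coefficient is below [lam / 2] by [hk2]. *)
have QH := @frob_young R N n (k2 * lam / (2 * k1)) (M - J *m M) H
  ltac:(by rewrite divr_gt0 ?mulr_gt0).
have gapQ := Lgap Q1; have gapH := Lgap H0; have normX := Lnorm X.
have x0 := frob_ge0 X; have h0 := frob_ge0 H.
have q0 := frob_ge0 (M - J *m M); have p0 := frob_ge0 (J *m M).
rewrite !(frobNl, frobNr, opprK) in XJM2.
rewrite MQ; clear MQ Q1 H0.
(* Matrices and then their products are generalized, leaving inequalities between real numbers. *)
move: (J *m M) (J *m X) (L *m X) (L *m H) (M - J *m M) XG GX JX XJM1 XJM2 GJM HLX QH
  gapQ gapH normX x0 h0 q0 p0 => P JX_ LX LH Q.
move: (L *m Q) => LQ.
move: (frob X X) (frob X G) (frob G G) (frob JX_ JX_) (frob X P) (frob P P)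
  (frob G P) (frob H LX) (frob H H) (frob LX LX) (frob Q H) (frob Q Q)
  (frob Q LQ) (frob H LH) => xx xg gg jx xp p gp hlx h lx qh q qlq hlh.
move=> XG GX JX XJM1 XJM2 GJM HLX QH gapQ gapH normX x0 h0 q0 p0.
have ex_le : `|eps * xp| <= (xx + p) / 4.
  have xpP : `|xp| <= (xx + p) / 2 by rewrite ler_norml; apply/andP; split; lra.
  rewrite normrM gtr0_norm//.
  apply: (le_trans (ler_pM (ltW eps0) (normr_ge0 _) eps12 xpP)); lra.
move: ex_le; rewrite ler_norml => /andP[exp1 exp2].
have k1x : xx <= k1 * xx by rewrite ler_peMl// ltW.
have k3h : 0 <= k3^-1 * h by rewrite mulr_ge0// ltW.
rewrite invfM; split; first by lra.
have egp : eps * gp <= eps / 2 * (theta ^+ 2 * xx + p).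
  by rewrite -mulrA ler_pM2l//; lra.
have hlx_le : hlx <= lam / 4 * h + sigma ^+ 2 / lam * xx.
  apply: (le_trans HLX); rewrite lerD2l (_ : 4 * (lam / 4) = lam); last by field.
  by rewrite mulrAC ler_pM2r ?invr_gt0.
have qh_le : k1 * qh <= k2 * lam / 2 * q + lam / 2 * h.
  apply: (@le_trans _ _ (k2 * lam / 2 * q + k1 ^+ 2 / (k2 * lam) / 2 * h)).
    rewrite -ler_pdivlMl//; apply: (le_trans QH); rewrite le_eqVlt; apply/orP; left.
    by apply/eqP; field; rewrite !gt_eqF.
  rewrite lerD2l ler_wpM2r// ler_pM2r ?invr_gt0// ler_pdivrMr ?mulr_gt0//.
  by rewrite (_ : lam * (k2 * lam) = k2 * lam ^+ 2) ?(ltW k2_gt)//; ring.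
have k1g : k1 * (w * xx) <= k1 * xg by rewrite ler_pM2l.
have k2q : k2 * (lam * q) <= k2 * qlq by rewrite ler_pM2l.
have ejx : eps * k1 * jx <= eps * k1 * xx by rewrite ler_pM2l// mulr_gt0.
have ebx : eps * b * xx <= kappa / 2 * xx by rewrite ler_wpM2r.
(* The balance is [kappa - eps b] for [|X|^2], [k2 lam - k2 lam / 2] for [|Q|^2],
   [lam - lam / 4 - lam / 2] for [|H|^2] and [eps - eps / 2] for [|J M|^2]. *)
apply: (@le_trans _ _ (- (kappa / 2 * xx + k2 * lam / 2 * q + lam / 4 * h
                          + eps / 2 * p))).
  move: ebx; rewrite /b /kappa; lra.
have dS : delta * (xx + q + h + p) <=
    kappa / 2 * xx + k2 * lam / 2 * q + lam / 4 * h + eps / 2 * p.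
  rewrite !mulrDr !lerD// ler_wpM2r// /delta !ge_min lexx ?orbT//.
have k1q : 0 <= k1 * q by rewrite mulr_ge0// ltW.
have k1h : 0 <= k1 * h by rewrite mulr_ge0// ltW.
have k1p : 0 <= k1 * p by rewrite mulr_ge0// ltW.
have k3q : 0 <= k3^-1 * q by rewrite mulr_ge0// ltW.
have k3p : 0 <= k3^-1 * p by rewrite mulr_ge0// ltW.
have k3x : 0 <= k3^-1 * xx by rewrite mulr_ge0// ltW.
set U := (U in _ <= _ * U).
have US : U <= K * (xx + q + h + p) by rewrite /U /K; lra.
rewrite mulNr lerN2; apply: le_trans dS.
rewrite [leRHS](_ : _ = delta / K * (K * (xx + q + h + p))).
  by rewrite ler_pM2l// divr_gt0.
by rewrite mulrA divfK// gt_eqF.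
Qed.
End Lyapunov.

(** * Differentiation along a trajectory *)

Lemma is_derive_mulmxl (R : realType) N n m (A : 'M[R]_(m, N)) (M : R -> 'M[R]_(N, n))
    (M' : 'M[R]_(N, n)) (t : R) :
  (forall i j, is_derive t (1 : R) (fun s => M s i j) (M' i j)) ->
  forall i j, is_derive t (1 : R) (fun s => (A *m M s) i j) ((A *m M') i j).
Proof.
move=> dM i j.
rewrite (_ : (fun s => _) = \sum_k (fun s => A i k * M s k j)); last first.
  by apply/funext => s; rewrite mxE fct_sumE.
by rewrite mxE; apply: is_derive_sum.
Qed.

Lemma is_derive_lyap (R : realType) N n (k1 k3 eps : R)
    (X M H : R -> 'M[R]_(N, n)) (X' M' H' : 'M[R]_(N, n)) (t : R) :
  (forall i j, is_derive t (1 : R) (fun s => X s i j) (X' i j)) ->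
  (forall i j, is_derive t (1 : R) (fun s => M s i j) (M' i j)) ->
  (forall i j, is_derive t (1 : R) (fun s => H s i j) (H' i j)) ->
  is_derive t (1 : R) (fun s => lyap k1 k3 eps (X s) (M s) (H s))
    (lyap_rate k1 k3 eps (X t) (M t) (H t) X' M' H').
Proof.
move=> dX dM dH.
have dXX := is_derive_frob dX dX; have dMM := is_derive_frob dM dM.
have dHH := is_derive_frob dH dH.
have dXJM := is_derive_frob dX (is_derive_mulmxl (mean_mx R N) dM).
apply: is_derive_eq; rewrite /lyap_rate (frobC X') (frobC M') (frobC H').
rewrite /GRing.scale/= invfM.
by move: k3^-1 => z; field.
Qed.

Lemma is_derive_coord (R : realType) m n (F : R -> 'M[R]_(m, n)) (t : R) F' i j :
  is_derive t (1 : R) F F' -> is_derive t (1 : R) (fun s => F s i j) (F' i j).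
Proof.
move=> dF; have dFt : derivable F t 1 by have [] := dF.
have -> : F' i j = 'D_1 (fun s => F s i j) t.
  by rewrite -(@derive_val _ _ _ _ _ _ _ dF) derive_mx// mxE.
by apply/derivableP; move/derivable_mxP : dFt.
Qed.

Lemma frob_rows (R : realType) N n (u v : 'I_N -> 'rV[R]_n) :
  frob (\matrix_i u i) (\matrix_i v i) = \sum_i frob (u i) (v i).
Proof.
rewrite frobE; apply: eq_bigr => i _; rewrite frobE big_ord1.
by apply: eq_bigr => j _; rewrite !mxE.
Qed.

Theorem theorem2 (R : realType) (N n : nat) (hN : (2 <= N)%N) (hn : (1 <= n)%N)
    (G : wdigraph R N) (hsc : strongly_connected G) (hwb : weight_balanced G)
    (lambda : seq R)
    (hlambda : ordered_eigenvalues
                 (2^-1 *: (laplacian G + (laplacian G)^T)) lambda)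
    (d : 'I_N -> 'rV[R]_n) (f : 'I_N -> 'rV[R]_n -> R) (omega theta : R)
    (homega : 0 < omega)
    (hdiff : forall (i : 'I_N) (u : 'rV[R]_n), differentiable (f i) u)
    (hconv : forall i : 'I_N, strongly_convex omega (f i))
    (hlip : forall i : 'I_N, elipschitz theta (grad (f i)))
    (k1 k2 k3 : R)
    (hk1 : Num.max (spectral_norm (laplacian G) ^+ 2 * (omega + 1)
                      / (lambda`_1 * omega ^+ 2)
                    + theta ^+ 2 / (2 * omega)) 1 < k1)
    (hk2 : k1 ^+ 2 / lambda`_1 ^+ 2 < k2)
    (hk3 : 0 < k3) :
  exists xs : 'I_N -> 'rV[R]_n,
    [/\ optimal f d xs,
        forall y : 'I_N -> 'rV[R]_n, optimal f d y -> y =1 xs &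
        exists2 c : R, 0 < c &
          forall x mu eta : 'I_N -> R -> 'rV[R]_n,
            trajectory G f d k1 k2 k3 x mu eta ->
            \sum_(i < N) eta i 0 = 0 ->
            exists2 C : R, 0 <= C &
              forall t : R, 0 <= t ->
                enorm (\matrix_(i < N) (x i t - xs i)) <= C * expR (- c * t)].
Proof.
have [lam0 gap] := laplacian_spectral_gap hwb hN hsc hlambda.
have N0 : (0 < N)%N := ltnW hN.
have [xs xs_opt] := optimal_exists d homega hdiff hconv.
exists xs; split => //.
  by move=> y; apply: (optimal_unique homega hdiff hconv xs_opt).
pose i0 : 'I_N := Ordinal N0; pose nu := grad (f i0) (xs i0).
have gradE i : grad (f i) (xs i) = nu by exact: (optimal_grad hdiff i i0 xs_opt).
move: hk1; rewrite gt_max => /andP[hk1' k1_gt1].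
have [eps [c [c0 diss]]] := lyap_dissipation N0 (laplacian_const G (n := n))
  (const_laplacian hwb) lam0 (gap n) (frob_spectral_norm (laplacian G) (p := n))
  homega hk1' k1_gt1 hk2 hk3.
(* [lyap] controls the squared norm, so the square root halves the rate. The choice precedes the
   trajectory. *)
exists (c / 2); first exact: divr_gt0.
move=> x mu eta traj eta0.
pose X t : 'M[R]_(N, n) := \matrix_i (x i t - xs i).
pose M t : 'M[R]_(N, n) := \matrix_i (mu i t - nu).
pose H t : 'M[R]_(N, n) := \matrix_i (eta i t - (xs i - d i)).
pose Gd t : 'M[R]_(N, n) := \matrix_i (grad (f i) (x i t) - nu).
pose X' t := - Gd t + M t.
pose M' t := k1 *: (H t - X t) - k2 *: (laplacian G *m M t).
pose H' t := - (k3 *: (laplacian G *m (H t - X t))).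
have entryB (y : 'I_N -> R -> 'rV[R]_n) z i j :
    (fun s : R => (\matrix_i (y i s - z i)) i j) =
    (fun s : R => y i s 0 j - z i 0 j).
  by apply/funext => s; rewrite !mxE.
have dX (t : R) : 0 < t -> forall i j, is_derive t (1 : R) (fun s => X s i j) (X' t i j).
  move=> t0 i j; have [_ _ _ /(_ t t0) [dx _ _]] := traj i.
  rewrite entryB; have := is_derive_coord 0 j dx => ?.
  by apply: is_derive_eq; rewrite !mxE; ring.
have dM (t : R) : 0 < t -> forall i j, is_derive t (1 : R) (fun s => M s i j) (M' t i j).
  move=> t0 i j; have [_ _ _ /(_ t t0) [_ dm _]] := traj i.
  rewrite (entryB _ (fun=> nu)); have := is_derive_coord 0 j dm => ?.
  apply: is_derive_eq.
  have -> : M' t i j = k1 * (H t i j - X t i j) - k2 * (laplacian G *m M t) i j.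
    by rewrite !mxE.
  (* The shifts by [xs] cancel in [H - X], which leaves [eta - x + d]; the common shift [nu] drops
     out of the differences. *)
  rewrite laplacian_mulmx !mxE summxE subr0; congr (_ - _); first by ring.
  by congr (_ * _); apply: eq_bigr => k _; rewrite !mxE; ring.
have dH (t : R) : 0 < t -> forall i j, is_derive t (1 : R) (fun s => H s i j) (H' t i j).
  move=> t0 i j; have [_ _ _ /(_ t t0) [_ _ de]] := traj i.
  rewrite (entryB _ (fun i => xs i - d i)); have := is_derive_coord 0 j de => ?.
  apply: is_derive_eq.
  have -> : H' t i j = - (k3 * (laplacian G *m (H t - X t)) i j) by rewrite !mxE.
  rewrite laplacian_mulmx !mxE summxE subr0; congr (- (_ * _)).
  by apply: eq_bigr => k _; rewrite !mxE; ring.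
have cB (g : R -> 'rV[R]_n) z (j : 'I_n) : {within `[(0 : R), +oo[, continuous g} ->
    {within `[(0 : R), +oo[, continuous (fun s => g s 0 j - z)}.
  move=> cg; have cz : {within `[(0 : R), +oo[, continuous (fun=> z : R)}.
    by apply: continuous_subspaceT => r; exact: cst_continuous.
  have cj : {within `[(0 : R), +oo[, continuous (fun s => g s 0 j)}.
    by move=> s; exact: (continuous_comp (cg s) (@coord_continuous R 1 n 0 j (g s))).
  by move=> s; exact: (continuousB (cj s) (cz s)).
have cX i j : {within `[(0 : R), +oo[, continuous (fun s => X s i j)}.
  rewrite (entryB _ xs); have [cx _ _ _] := traj i; exact: cB.
have cM i j : {within `[(0 : R), +oo[, continuous (fun s => M s i j)}.
  rewrite (entryB _ (fun=> nu)); have [_ cm _ _] := traj i; exact: cB.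
have cH i j : {within `[(0 : R), +oo[, continuous (fun s => H s i j)}.
  rewrite (entryB _ (fun i => xs i - d i)); have [_ _ ce _] := traj i; exact: cB.
(* The column sums [S] of [H] have zero derivative, so [exp_decay] with rate 0 bounds [|S|^2] by its
   initial value, which vanishes by the initial condition and the feasibility of [xs]. *)
have H1 t : 0 <= t -> (const_mx 1 : 'rV_N) *m H t = 0.
  pose S t := (const_mx 1 : 'rV_N) *m H t.
  have dS (r : R) : 0 < r -> is_derive r (1 : R) (fun s => frob (S s) (S s)) 0.
    move=> r0; have dS i j : is_derive r (1 : R) (fun s => S s i j) ((0 : 'rV[R]_n) i j).
      have <- : (const_mx 1 : 'rV_N) *m H' r = 0.
        by rewrite mulmxN -scalemxAr mulmxA const_laplacian// mul0mx scaler0 oppr0.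
      exact: is_derive_mulmxl (dH r r0) i j.
    by have := is_derive_frob dS dS; rewrite frob0r frobC frob0r addr0.
  have cS : {within `[(0 : R), +oo[, continuous (fun s => frob (S s) (S s))}.
    have cS i j : {within `[(0 : R), +oo[, continuous (fun s => S s i j)}.
      by apply: continuous_mulmx => // k l; exact: cst_continuous.
    exact: continuous_frob.
  move=> t0; apply/frob_eq0/eqP; rewrite eq_le frob_ge0 andbT.
  apply: le_trans (exp_decay (c := 0) cS dS _ t0) _.
    by move=> r _; rewrite oppr0 mul0r.
  rewrite (_ : S 0 = 0) ?frob0r ?mul0r//.
  have [xf _] := xs_opt.
  have : \sum_i (eta i 0 - (xs i - d i)) = 0.
    by rewrite !sumrB eta0 xf subrr subr0.
  move=> /rowP sum0; apply/rowP => j; have := sum0 j.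
  rewrite summxE => {}sum0; rewrite [LHS]mxE -[RHS]sum0.
  by apply: eq_bigr => i _; rewrite !mxE mul1r.
pose U t := lyap k1 k3 eps (X t) (M t) (H t).
have UX t : 0 <= t -> 4^-1 * frob (X t) (X t) <= U t /\
    lyap_rate k1 k3 eps (X t) (M t) (H t) (X' t) (M' t) (H' t) <= - c * U t.
  move=> t0; apply: diss; first exact: H1.
    rewrite !frob_rows mulr_sumr; apply: ler_sum => i _.
    by rewrite -(gradE i); exact: strongly_convex_frob.
  rewrite !frob_rows mulr_sumr; apply: ler_sum => i _.
  rewrite -(gradE i) -!enorm_sqr -exprMn lerXn2r ?nnegrE ?enorm_ge0//.
    (* Squaring requires a nonnegative right-hand side, which the Lipschitz inequality itself
       provides. *)
    exact: le_trans (enorm_ge0 _) (hlip i _ _).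
  exact: hlip.
have decay : forall t : R, 0 <= t -> U t <= U 0 * expR (- c * t).
  apply: (@exp_decay _ U (fun t =>
    lyap_rate k1 k3 eps (X t) (M t) (H t) (X' t) (M' t) (H' t))).
  - have ccst (a : R) : {within `[(0 : R), +oo[, continuous (fun=> a)}.
      by apply: continuous_subspaceT => r; exact: cst_continuous.
    have cJM := continuous_mulmx (f := fun=> mean_mx R N) (fun i j => ccst _) cM.
    have cXX := continuous_frob cX cX; have cMM := continuous_frob cM cM.
    have cHH := continuous_frob cH cH; have cXJM := continuous_frob cX cJM.
    move=> s; exact: (continuousB (continuousD (continuousD
      (continuousM (ccst _ s) (cXX s)) (continuousM (ccst _ s) (cMM s)))
      (continuousM (ccst _ s) (cHH s))) (continuousM (ccst _ s) (cXJM s))).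
  - by move=> t t0; apply: is_derive_lyap; [exact: dX|exact: dM|exact: dH].
  - by move=> t /ltW/UX[].
(* From [|X t|^2 / 4 <= U t <= U 0 * expR (- c * t)]. *)
exists (Num.sqrt (4 * U 0)); first exact: sqrtr_ge0.
move=> t t0; rewrite -/(X t) enormE.
have -> : expR (- (c / 2) * t) = Num.sqrt (expR (- c * t)).
  rewrite (_ : - c * t = - (c / 2) * t + - (c / 2) * t); last by field.
  by rewrite expRD -expr2 sqrtr_sqr ger0_norm// expR_ge0.
have U0 : 0 <= U 0.
  by have [h _] := UX 0 (lexx 0); apply: le_trans h; rewrite mulr_ge0 ?frob_ge0.
rewrite -sqrtrM; last by rewrite mulr_ge0.
rewrite ler_wsqrtr//; have [h _] := UX t t0; have := decay t t0; lra.
Qed.
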